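(* Let $K$ be a loop with identity $\epsilon$, let $N$ be a loop with identity $e$, and let $K\times^{\triangledown}N$ be a Bruck extension of $N$ by $K$. For $\alpha\in K$ let $\varphi_\alpha:N\to N$ be the map $\varphi_\alpha(x)=\triangledown_{\alpha,\epsilon}(e,x)$. Define, for $\alpha,\beta\in K$ and $a,b\in N$, $$\triangledown^*_{\alpha,\beta}(a,b)=\varphi_{\alpha\beta}^{-1}\big(\triangledown_{\alpha,\beta}(\varphi_\alpha(a),\varphi_\beta(b))\big).$$ Then the family $\triangledown^*$ determines an Albert extension $K\times^{\triangledown^*}N$, and the map $\Phi:(\xi,x)\mapsto(\xi,\varphi_\xi(x))$ is an isomorphism of the Albert extension $K\times^{\triangledown^*}N$ onto the Bruck extension $K\times^{\triangledown}N$. Moreover, $\Phi$ induces the identity map on the normal subloop $\{\epsilon\}\times N$.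
   Context: A quasigroup is a set with a binary multiplication all of whose left and right translations are bijective; a loop is a quasigroup with an identity element. Let $K$ be a loop with identity $\epsilon$ and $N$ a loop with identity $e$. Suppose that for all $\alpha,\beta\in K$ a quasigroup multiplication $\triangledown_{\alpha,\beta}:N\times N\to N$ is given such that (i) $\triangledown_{\epsilon,\epsilon}$ is the multiplication of $N$; (ii) $e$ is a left identity element of $\triangledown_{\epsilon,\alpha}$ for all $\alpha\in K$; (iii) $e$ is a right identity element of $\triangledown_{\alpha,\epsilon}$ for all $\alpha\in K$. The Bruck extension $K\times^{\triangledown}N$ is the loop on the set $K\times N$ with multiplication $(\alpha,a)(\beta,b)=(\alpha\beta,\triangledown_{\alpha,\beta}(a,b))$. It is called an Albert extension of $N$ by $K$ if moreover $e$ is a two-sided identity element of $\triangledown_{\alpha,\epsilon}$ for every $\alpha\in K$. *)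

(* Defs.v *)
From HB Require Import structures.
From mathcomp Require Import all_boot.
From mathcomp Require Import boolp classical_sets functions.

Set Implicit Arguments.
Unset Strict Implicit.
Unset Printing Implicit Defensive.

Local Open Scope group_scope.
Local Open Scope classical_set_scope.

Definition quasigroup_law (T : Type) (op : T -> T -> T) : Prop :=
  (forall a, bijective (fun x => op a x)) /\
  (forall b, bijective (fun x => op x b)).

(* Built on baseUMagmaType rather than on umagmaType, because the latter also
   requires a choiceType. *)
HB.mixin Record BaseUMagma_isLoop G of BaseUMagma G := {
  loop_mul1g : left_id 1 (@mul G);
  loop_mulg1 : right_id 1 (@mul G);
  loop_quasigroup : quasigroup_law (@mul G)
}.

#[short(type="loopType")]
HB.structure Definition Loop := {G of BaseUMagma_isLoop G & BaseUMagma G}.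

Bind Scope group_scope with Loop.sort.

Definition loop_isomorphism (L M : loopType) (f : L -> M) : Prop :=
  bijective f /\ {morph f : x y / x * y}.

(* The two cancellation clauses are closure under left and right division. *)
Definition subloop (L : loopType) (S : set L) : Prop :=
  [/\ S 1,
      forall x y, S x -> S y -> S (x * y),
      forall x y, S x -> S (x * y) -> S y
    & forall x y, S y -> S (x * y) -> S x].

Definition normal_subloop (L : loopType) (S : set L) : Prop :=
  [/\ subloop S,
      forall x, [set x * s | s in S] = [set s * x | s in S],
      forall x y, [set x * (y * s) | s in S] = [set (x * y) * s | s in S]
    & forall x y, [set (s * x) * y | s in S] = [set s * (x * y) | s in S]].

Record bruck_axioms (K N : loopType) (T : K -> K -> N -> N -> N) : Prop :=
  BruckAxioms {
    bruck_quasigroup : forall alpha beta, quasigroup_law (T alpha beta);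
    bruck_mul : forall a b, T 1 1 a b = a * b;
    bruck_left_id : forall alpha, left_id 1 (T 1 alpha);
    bruck_right_id : forall alpha, right_id 1 (T alpha 1)
  }.

Record bruckFamily (K N : loopType) := BruckFamily {
  bruck_op :> K -> K -> N -> N -> N;
  bruck_opP : bruck_axioms bruck_op
}.

Definition albert (K N : loopType) (T : bruckFamily K N) : Prop :=
  forall alpha, left_id 1 (T alpha 1) /\ right_id 1 (T alpha 1).

(* An alias of K * N, so that the multiplication depends on the family. *)
Definition bruck_ext (K N : loopType) (T : bruckFamily K N) : Type :=
  (K * N)%type.

Section BruckExtension.
Variables (K N : loopType) (T : bruckFamily K N).

Definition bruck_ext_mul (x y : bruck_ext T) : bruck_ext T :=
  (x.1 * y.1, T x.1 y.1 x.2 y.2).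

Definition bruck_ext_one : bruck_ext T := (1, 1).

Lemma bruck_ext_mul1 : left_id bruck_ext_one bruck_ext_mul.
Proof.
by case=> xi x; rewrite /bruck_ext_mul /= loop_mul1g (bruck_left_id (bruck_opP T)).
Qed.

Lemma bruck_ext_mulr1 : right_id bruck_ext_one bruck_ext_mul.
Proof.
by case=> xi x; rewrite /bruck_ext_mul /= loop_mulg1 (bruck_right_id (bruck_opP T)).
Qed.

Lemma bij_fibered (f : K -> K) (g : K -> N -> N) :
  bijective f -> (forall xi, bijective (g xi)) ->
  bijective (fun z : K * N => (f z.1, g z.1 z.2)).
Proof.
move=> [f' fK f'K] gbij.
have /choice [g' g'P] : forall xi, exists h, cancel (g xi) h /\ cancel h (g xi).
  by move=> xi; have [h ? ?] := gbij xi; exists h.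
exists (fun z => (f' z.1, g' (f' z.1) z.2)) => -[xi x] /=.
  by rewrite fK (proj1 (g'P xi)).
by rewrite f'K (proj2 (g'P _)).
Qed.

Lemma bruck_ext_quasigroup : quasigroup_law bruck_ext_mul.
Proof.
have [Kl Kr] := @loop_quasigroup K.
split=> -[alpha a].
- apply: (@bij_fibered (fun xi => alpha * xi) (fun xi x => T alpha xi a x)) => [|xi].
  exact: Kl.
  exact: (proj1 (bruck_quasigroup (bruck_opP T) alpha xi)).
- apply: (@bij_fibered (fun xi => xi * alpha) (fun xi x => T xi alpha x a)) => [|xi].
  exact: Kr.
  exact: (proj2 (bruck_quasigroup (bruck_opP T) xi alpha)).
Qed.

HB.instance Definition _ := hasMul.Build (bruck_ext T) bruck_ext_mul.
HB.instance Definition _ := hasOne.Build (bruck_ext T) bruck_ext_one.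
HB.instance Definition _ :=
  BaseUMagma_isLoop.Build (bruck_ext T)
    bruck_ext_mul1 bruck_ext_mulr1 bruck_ext_quasigroup.

Definition bruck_kernel : set (bruck_ext T) := [set 1] `*` [set: N].

Definition bruck_phi (alpha : K) (x : N) : N := T alpha 1 1 x.

(* 'pinv_ is the inverse of bruck_phi, which is a left translation of a
   quasigroup, hence bijective; the default value is never reached. *)
Definition bruck_star (alpha beta : K) (a b : N) : N :=
  'pinv_(fun=> 1) [set: N] (bruck_phi (alpha * beta))
    (T alpha beta (bruck_phi alpha a) (bruck_phi beta b)).

End BruckExtension.

Definition bruck_Phi (K N : loopType) (A T : bruckFamily K N)
  (z : bruck_ext A) : bruck_ext T := (z.1, bruck_phi T z.1 z.2).

(* Main.v *)
(* Each phi_alpha is a left translation of a quasigroup, so the star operations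
   are isotopic to the original ones.  Moreover phi_1 = id and every phi_alpha
   fixes the identity of N; this gives the identity laws of the Albert
   extension.  The subloop {1} x N is the kernel of the first projection onto K,
   and kernels of loop homomorphisms are normal: each coset occurring in the
   definition of normality is the whole fiber over the corresponding product. *)
Require Import Defs.
From mathcomp Require Import all_boot.
From mathcomp Require Import classical_sets functions.

Local Open Scope group_scope.
Local Open Scope classical_set_scope.

Lemma loop_mul_bijl (L : loopType) (x : L) : bijective (fun y => x * y).
Proof. exact: (proj1 (@loop_quasigroup L)). Qed.

Lemma loop_mul_bijr (L : loopType) (y : L) : bijective (fun x => x * y).
Proof. exact: (proj2 (@loop_quasigroup L)). Qed.

Lemma loop_mulgI (L : loopType) (x : L) : injective (fun y => x * y).
Proof. exact/bij_inj/loop_mul_bijl. Qed.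

Lemma loop_mulIg (L : loopType) (y : L) : injective (fun x => x * y).
Proof. exact/bij_inj/loop_mul_bijr. Qed.

Section KernelNormal.
Variables (L M : loopType) (p : L -> M).
Hypothesis pM : {morph p : x y / x * y}.

Lemma loop_morph1 : p 1 = 1.
Proof. by apply: (@loop_mulgI M (p 1)); rewrite /= -pM !loop_mulg1. Qed.

(** Surjectivity of [f] supplies a preimage of each point over [g c], and injectivity of [g] forces
    that preimage to lie over [c]. *)
Lemma image_fiber {f : L -> L} {g : M -> M} (c : M) :
  bijective f -> injective g -> (forall x, p (f x) = g (p x)) ->
  [set f s | s in [set x | p x = c]] = [set z | p z = g c].
Proof.
move=> [f' _ f'K] gI pf; apply/seteqP; split=> z /=.
  by case=> s <- <-.
by move=> pz; exists (f' z) => //; apply: gI; rewrite -pf f'K.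
Qed.

Lemma image_mulg_fiber (c : M) (x : L) :
  [set x * s | s in [set z | p z = c]] = [set z | p z = p x * c].
Proof.
exact: image_fiber c (loop_mul_bijl L x) (@loop_mulgI M (p x)) (pM x).
Qed.

Lemma image_mulgr_fiber (c : M) (x : L) :
  [set s * x | s in [set z | p z = c]] = [set z | p z = c * p x].
Proof.
exact: image_fiber c (loop_mul_bijr L x) (@loop_mulIg M (p x)) (pM^~ x).
Qed.

Lemma kernel_normal_subloop : normal_subloop [set x | p x = 1].
Proof.
split=> [|x|x y|x y].
- split=> [|x y|x y|x y] /=; first exact: loop_morph1.
  + by rewrite pM => -> ->; rewrite loop_mulg1.
  + by rewrite pM => ->; rewrite loop_mul1g.
  + by rewrite pM => ->; rewrite loop_mulg1.
- by rewrite image_mulg_fiber image_mulgr_fiber loop_mulg1 loop_mul1g.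
- rewrite image_mulg_fiber -(image_comp (fun s => y * s) (fun s => x * s)).
  by rewrite !image_mulg_fiber !loop_mulg1 pM.
- rewrite image_mulgr_fiber -(image_comp (fun s => s * x) (fun s => s * y)).
  by rewrite !image_mulgr_fiber !loop_mul1g pM.
Qed.

End KernelNormal.

Lemma bruck_kernel_normal (K N : loopType) (T : bruckFamily K N) :
  normal_subloop (@bruck_kernel K N T).
Proof.
have -> : @bruck_kernel K N T = [set z : bruck_ext T | z.1 = 1].
  by apply/seteqP; split=> z; [case | split].
(* The first projection is multiplicative by computation. *)
exact: (@kernel_normal_subloop (bruck_ext T) K (fun z => z.1)).
Qed.

Section BruckStar.
Variables (K N : loopType) (T : bruckFamily K N).
Let axT := bruck_opP T.

Lemma bruck_phi_bij (alpha : K) : bijective (bruck_phi T alpha).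
Proof. exact: (proj1 (bruck_quasigroup axT alpha 1)). Qed.

Lemma bruck_phi1 (x : N) : bruck_phi T 1 x = x.
Proof. by rewrite /bruck_phi (bruck_left_id axT). Qed.

Lemma bruck_phi_fix1 (alpha : K) : bruck_phi T alpha 1 = 1.
Proof. by rewrite /bruck_phi (bruck_right_id axT). Qed.

Let phi_inv (alpha : K) := 'pinv_(fun=> 1) [set: N] (bruck_phi T alpha).

Lemma bruck_phiK (alpha : K) : cancel (bruck_phi T alpha) (phi_inv alpha).
Proof.
move=> x; apply: pinvKV; last by rewrite inE.
by move=> ? ? _ _; apply/bij_inj/bruck_phi_bij.
Qed.

Lemma bruck_phi_invK (alpha : K) : cancel (phi_inv alpha) (bruck_phi T alpha).
Proof. exact/(bij_can_sym (bruck_phi_bij alpha))/bruck_phiK. Qed.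

Lemma bruck_phi_inv_bij (alpha : K) : bijective (phi_inv alpha).
Proof. exact: bij_can_bij (bruck_phi_bij alpha) _ (bruck_phiK alpha). Qed.

(** This inverse-free form of the definition yields the identity laws of the star operations and is
    also the multiplicativity of [bruck_Phi]. *)
Lemma bruck_phi_star (alpha beta : K) (a b : N) :
  bruck_phi T (alpha * beta) (bruck_star T alpha beta a b) =
  T alpha beta (bruck_phi T alpha a) (bruck_phi T beta b).
Proof. exact: bruck_phi_invK. Qed.

Lemma bruck_star_left_id (alpha : K) : left_id 1 (bruck_star T 1 alpha).
Proof.
(* The index stays a product so that [bruck_phi_star] applies. *)
move=> b; apply: (bij_inj (bruck_phi_bij (1 * alpha))).
by rewrite bruck_phi_star bruck_phi_fix1 (bruck_left_id axT) loop_mul1g.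
Qed.

Lemma bruck_star_right_id (alpha : K) : right_id 1 (bruck_star T alpha 1).
Proof.
move=> a; apply: (bij_inj (bruck_phi_bij (alpha * 1))).
by rewrite bruck_phi_star bruck_phi_fix1 (bruck_right_id axT) loop_mulg1.
Qed.

(** This is the extra Albert law, and the reason for the choice of [bruck_phi]: after applying it,
    the left side becomes [T alpha 1 1 b], which is [bruck_phi T alpha b] by definition. *)
Lemma bruck_star_left_id1 (alpha : K) : left_id 1 (bruck_star T alpha 1).
Proof.
move=> b; apply: (bij_inj (bruck_phi_bij (alpha * 1))).
by rewrite bruck_phi_star bruck_phi_fix1 bruck_phi1 loop_mulg1.
Qed.

Lemma bruck_star_axioms : bruck_axioms (bruck_star T).
Proof.
split=> [alpha beta|a b||].
- have [Tl Tr] := bruck_quasigroup axT alpha beta.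
  split=> c; apply: (bij_comp (bruck_phi_inv_bij (alpha * beta))).
  + exact: bij_comp (Tl _) (bruck_phi_bij beta).
  + exact: bij_comp (Tr _) (bruck_phi_bij alpha).
(* The identity map [bruck_phi T 1] is inserted and its index written as [1 * 1], to match
   [bruck_phi_star]. *)
- rewrite -(bruck_phi1 (bruck_star T 1 1 a b)) -[X in bruck_phi T X](loop_mulg1 1).
  by rewrite bruck_phi_star !bruck_phi1 (bruck_mul axT).
- exact: bruck_star_left_id.
- exact: bruck_star_right_id.
Qed.

End BruckStar.

Theorem theorem7 (K N : loopType) (T : bruckFamily K N) :
  (forall alpha : K, bijective (bruck_phi T alpha)) /\
  exists A : bruckFamily K N,
    (forall (alpha beta : K) (a b : N),
       A alpha beta a b = bruck_star T alpha beta a b) /\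
    albert A /\
    loop_isomorphism (@bruck_Phi K N A T) /\
    normal_subloop (@bruck_kernel K N A) /\
    normal_subloop (@bruck_kernel K N T) /\
    (forall x : N, @bruck_Phi K N A T (1, x) = (1, x)).
Proof.
split; first exact: bruck_phi_bij.
exists (BruckFamily (bruck_star_axioms _ _ T)).
split; first by [].
split=> [alpha|].
  by split; [exact: bruck_star_left_id1 | exact: bruck_star_right_id].
split; first split.
(* [bruck_Phi] covers the identity of [K] and is bijective on each fiber. *)
- by apply: (@bij_fibered K N id (bruck_phi T)); [exists id | exact: bruck_phi_bij].
- by case=> alpha a [beta b]; congr pair; exact: bruck_phi_star.
- do 2![split; first exact: bruck_kernel_normal].
  by move=> x; congr pair; exact: bruck_phi1.
Qed.
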